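(* Let $A\in \mathbb{C}^{m\times n}$, $U\in \mathbb{C}^{m\times r}$, and $V\in \mathbb{C}^{n\times r}$, and let $S_{A}=I+V^{\ast}A^{\dagger}U\in\mathbb{C}^{r\times r}$. If $\mathcal{R}(U)\subseteq \mathcal{R}(A)$ and $\mathcal{R}(V)\subseteq \mathcal{R}(A^{\ast})$, then the identity $$(A+UV^{\ast})^{\dagger}=\big(I+A^{\dagger}UF_{S_{A}}U^{\ast}(A^{\dagger})^{\ast}\big)^{-1}\big(A^{\dagger}-A^{\dagger}US_{A}^{\dagger}V^{\ast}A^{\dagger}\big)\big(I+(A^{\dagger})^{\ast}VE_{S_{A}}V^{\ast}A^{\dagger}\big)^{-1}$$ holds if and only if both $UE_{S_{A}}V^{\ast}A^{\dagger}$ and $A^{\dagger}UF_{S_{A}}V^{\ast}$ are Hermitian and $A^{\dagger}UF_{S_{A}}E_{S_{A}}V^{\ast}A^{\dagger}=0$.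
   Context: $\mathbb{C}^{m\times n}$ is the set of $m\times n$ complex matrices; $I$ is an identity matrix of the appropriate size. For a complex matrix $B$, $B^{\ast}$ is its conjugate transpose, $\mathcal{R}(B)$ its range (column space), and $B^{\dagger}$ its Moore--Penrose inverse, i.e. the unique matrix $Z$ with $BZB=B$, $ZBZ=Z$, $(BZ)^{\ast}=BZ$, $(ZB)^{\ast}=ZB$. Further, $E_{B}=I-BB^{\dagger}$ and $F_{B}=I-B^{\dagger}B$. The two matrices that are inverted in the formula are identity plus Hermitian positive semidefinite matrices, hence nonsingular. *)

(* Defs.v *)
From mathcomp Require Import all_boot all_order all_algebra.
From mathcomp Require Import sesquilinear spectral.
From mathcomp Require Import reals complex.

Set Implicit Arguments.
Unset Strict Implicit.
Unset Printing Implicit Defensive.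

Import GRing.Theory Num.Theory.
Local Open Scope ring_scope.
Local Open Scope sesquilinear_scope.

Section MoorePenrose.
Variable C : numClosedFieldType.

Lemma trmxC_mul m n p (A : 'M[C]_(m, n)) (B : 'M[C]_(n, p)) :
  (A *m B) ^t* = B ^t* *m A ^t*.
Proof. by rewrite trmx_mul map_mxM. Qed.

Lemma gram_entry_ge0 m n (B : 'M[C]_(m, n)) i : 0 <= (B *m B ^t*) i i.
Proof. by rewrite !mxE sumr_ge0 // => j _; rewrite !mxE mul_conjC_ge0. Qed.

Lemma gram_eq0 m n (B : 'M[C]_(m, n)) :
  (forall i, (B *m B ^t*) i i = 0) -> B = 0.
Proof.
move=> B0; apply/matrixP => i j; move/eqP: (B0 i); rewrite !mxE psumr_eq0.
  by move=> /allP/(_ j); rewrite mem_index_enum !mxE mul_conjC_eq0 => /(_ isT)/eqP.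
by move=> k _; rewrite !mxE mul_conjC_ge0.
Qed.

Lemma gram_unitmx m n (B : 'M[C]_(m, n)) :
  row_free B -> B *m B ^t* \in unitmx.
Proof.
move=> fB; rewrite -row_free_unit; apply/inj_row_free => v vBB.
apply: (row_free_inj fB); rewrite mul0mx; apply: gram_eq0 => i.
by rewrite trmxC_mul mulmxA -(mulmxA v) vBB mul0mx mxE.
Qed.

Lemma unitmx_add1_gram m n (B : 'M[C]_(m, n)) :
  1%:M + B *m B ^t* \in unitmx.
Proof.
rewrite -row_free_unit; apply/inj_row_free => v v0.
apply: gram_eq0 => i.
have /matrixP/(_ i i) : v *m v ^t* + (v *m B) *m (v *m B) ^t* = 0.
  by rewrite trmxC_mul !mulmxA -mulmxDl -[X in X + _]mulmx1 -mulmxA -mulmxDr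
             v0 mul0mx.
rewrite mxE [RHS]mxE => /eqP; rewrite paddr_eq0 ?gram_entry_ge0 //.
by case/andP => /eqP.
Qed.

Definition is_mpinv m n (B : 'M[C]_(m, n)) (Z : 'M[C]_(n, m)) : bool :=
  [&& B *m Z *m B == B, Z *m B *m Z == Z,
      (B *m Z) ^t* == B *m Z & (Z *m B) ^t* == Z *m B].

Lemma mpinv_exists_factor m k n (P : 'M[C]_(m, k)) (Q : 'M[C]_(k, n)) :
  row_full P -> row_free Q -> exists Z, is_mpinv (P *m Q) Z.
Proof.
move=> fP fQ; have uQ := gram_unitmx fQ.
have uP : P ^t* *m P \in unitmx.
  rewrite -[P in X in _ *m X]trmxCK; apply: gram_unitmx.
  by rewrite /row_free mxrank_map mxrank_tr.
pose G := invmx (P ^t* *m P) *m P ^t*; pose H := Q ^t* *m invmx (Q *m Q ^t*).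
have GP : G *m P = 1%:M by rewrite -mulmxA mulVmx.
have QH : Q *m H = 1%:M by rewrite mulmxA mulmxV.
have BZ : P *m Q *m (H *m G) = P *m G by rewrite mulmxA -(mulmxA P) QH mulmx1.
have ZB : H *m G *m (P *m Q) = H *m Q by rewrite mulmxA -(mulmxA H) GP mulmx1.
exists (H *m G); rewrite /is_mpinv BZ ZB; apply/and4P; split; apply/eqP.
- by rewrite mulmxA -(mulmxA P) GP mulmx1.
- by rewrite mulmxA -(mulmxA H) QH mulmx1.
- by rewrite /G !trmxC_mul trmxCK trmx_inv map_invmx trmxC_mul trmxCK mulmxA.
- by rewrite /H !trmxC_mul trmxCK trmx_inv map_invmx trmxC_mul trmxCK mulmxA.
Qed.

Lemma mpinv_exists m n (B : 'M[C]_(m, n)) : exists Z, is_mpinv B Z.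
Proof.
have := mpinv_exists_factor (col_base_full B) (row_base_free B).
by rewrite mulmx_base.
Qed.

Definition mpinv m n (B : 'M[C]_(m, n)) : 'M[C]_(n, m) :=
  xchoose (mpinv_exists B).

Lemma mpinvP m n (B : 'M[C]_(m, n)) : is_mpinv B (mpinv B).
Proof. exact: xchooseP. Qed.

Lemma mpinv_unique m n (B : 'M[C]_(m, n)) Z : is_mpinv B Z -> Z = mpinv B.
Proof.
have := mpinvP B; move: (mpinv B) => W.
case/and4P => /eqP BWB /eqP WBW /eqP BW /eqP WB.
case/and4P => /eqP BZB /eqP ZBZ /eqP BZ /eqP ZB.
have BZW : B *m Z = B *m W.
  have e : (B *m Z) *m (B *m W) = B *m W by rewrite mulmxA BZB.
  have e' : (B *m W) *m (B *m Z) = B *m Z by rewrite mulmxA BWB.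
  by rewrite -e' -[LHS]trmxCK trmxC_mul BW BZ e BW.
have ZBW : Z *m B = W *m B.
  have e : (Z *m B) *m (W *m B) = Z *m B by rewrite -mulmxA (mulmxA B) BWB.
  have e' : (W *m B) *m (Z *m B) = W *m B by rewrite -mulmxA (mulmxA B) BZB.
  by rewrite -e -[LHS]trmxCK trmxC_mul WB ZB e' WB.
by rewrite -ZBZ ZBW -mulmxA BZW mulmxA WBW.
Qed.

Definition Eproj m n (B : 'M[C]_(m, n)) : 'M[C]_m := 1%:M - B *m mpinv B.

Definition Fproj m n (B : 'M[C]_(m, n)) : 'M[C]_n := 1%:M - mpinv B *m B.

Definition colrange m n (B : 'M[C]_(m, n)) : {vspace 'cV[C]_m} :=
  limg (linfun (mulmx B : 'cV[C]_n -> 'cV[C]_m)).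

Lemma colrangeP m n (B : 'M[C]_(m, n)) (y : 'cV[C]_m) :
  reflect (exists x : 'cV[C]_n, y = B *m x) (y \in colrange B).
Proof.
apply: (iffP memv_imgP) => [[x _ ->]|[x ->]]; exists x; rewrite ?memvf //.
  by rewrite lfunE.
by rewrite lfunE.
Qed.

End MoorePenrose.

(* Main.v *)
Require Import Defs.
From mathcomp Require Import all_boot all_order all_algebra.
From mathcomp Require Import sesquilinear spectral reals complex.

(** Put X := A^+ U, Y := V^* A^+, M := A + U V^*, S := I + Y U = I + V^* X, and
    let E, F be the orthogonal projectors with E S = 0 and S F = 0.  The two
    range inclusions say U = A X and V^* = Y A.  The formula under study is
    M^+ = N with N := K^-1 G L^-1, where G := A^+ - X S^+ Y is the
    Sherman-Morrison-Woodbury candidate, K := I + X F X^* and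
    L := I + Y^* E Y.  Expanding gives
    [M G = A A^+ + U E Y,   G M = A^+ A + X F V^*,   M X F = 0,   E Y M = 0,]
    so that M K = M and L M = M: the correction factors are invisible to M, and
    M N M = M holds unconditionally.  The other three Penrose equations for N
    correspond one by one to the three stated conditions.

    - M N = M G L^-1 is congruent to L (M N) L = L (M G), and L (M G) = M G
      because E Y U = - E; as A A^+ is Hermitian, M N is Hermitian if and only
      if U E Y is.
    - Dually, K (N M) K = (G M) K = G M, so N M is Hermitian if and only if
      X F V^* is.
    - Cancelling K and L, N M N = N reads G (M G) = G, that is G U E Y = 0; and
      G U E = X F E because S^+ E = 0. *)

Set Implicit Arguments.
Unset Strict Implicit.
Unset Printing Implicit Defensive.

Import GRing.Theory Num.Theory.
Local Open Scope ring_scope.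
Local Open Scope sesquilinear_scope.

Section PenroseEquations.
Variable C : numClosedFieldType.

Lemma hermsymmxP n (B : 'M[C]_n) : reflect (B ^t* = B) (B \is hermsymmx).
Proof.
apply: (iffP (is_hermitianmxP _ _ _)); rewrite expr0 scale1r => /esym //.
Qed.

Lemma trmxCD m n (B D : 'M[C]_(m, n)) : (B + D) ^t* = B ^t* + D ^t*.
Proof. by rewrite linearD map_mxD. Qed.

Lemma trmxCB m n (B D : 'M[C]_(m, n)) : (B - D) ^t* = B ^t* - D ^t*.
Proof. by rewrite linearB map_mxB. Qed.

Lemma trmxC1 n : (1%:M : 'M[C]_n) ^t* = 1%:M.
Proof. by rewrite trmx1 map_mx1. Qed.

Lemma hermitian_congr n (L H : 'M[C]_n) :
  L \in unitmx -> L ^t* = L -> (H ^t* = H) <-> ((L *m H *m L) ^t* = L *m H *m L).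
Proof.
move=> uL hL; rewrite !trmxC_mul hL mulmxA; split=> [-> //|e].
by apply: (can_inj (mulKmx uL)); apply: (can_inj (mulmxK uL)).
Qed.

Lemma hermitian_addl n (P H : 'M[C]_n) :
  P ^t* = P -> ((P + H) ^t* = P + H) <-> (H ^t* = H).
Proof. by move=> hP; rewrite trmxCD hP; split=> [/addrI|->]. Qed.

Variables (m n : nat) (B : 'M[C]_(m, n)).

Lemma mpinv_inner : B *m mpinv B *m B = B.
Proof. by case/and4P: (mpinvP B) => /eqP. Qed.

Lemma mpinv_outer : mpinv B *m B *m mpinv B = mpinv B.
Proof. by case/and4P: (mpinvP B) => _ /eqP. Qed.

Lemma mpinv_herml : (B *m mpinv B) ^t* = B *m mpinv B.
Proof. by case/and4P: (mpinvP B) => _ _ /eqP. Qed.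

Lemma mpinv_hermr : (mpinv B *m B) ^t* = mpinv B *m B.
Proof. by case/and4P: (mpinvP B) => _ _ _ /eqP. Qed.

Lemma mpinv_penrose (Z : 'M[C]_(n, m)) :
  mpinv B = Z <->
  [/\ B *m Z *m B = B, Z *m B *m Z = Z,
      (B *m Z) ^t* = B *m Z & (Z *m B) ^t* = Z *m B].
Proof.
split=> [<-|[e1 e2 e3 e4]].
  by rewrite mpinv_inner mpinv_outer mpinv_herml mpinv_hermr.
by symmetry; apply: mpinv_unique; rewrite /is_mpinv e1 e2 e3 e4 !eqxx.
Qed.

Lemma Eproj_herm : (Eproj B) ^t* = Eproj B.
Proof. by rewrite trmxCB trmxC1 mpinv_herml. Qed.

Lemma Fproj_herm : (Fproj B) ^t* = Fproj B.
Proof. by rewrite trmxCB trmxC1 mpinv_hermr. Qed.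

Lemma Eproj_mul : Eproj B *m B = 0.
Proof. by rewrite mulmxBl mul1mx mpinv_inner subrr. Qed.

Lemma mul_Fproj : B *m Fproj B = 0.
Proof. by rewrite mulmxBr mulmx1 mulmxA mpinv_inner subrr. Qed.

Lemma mpinv_Eproj : mpinv B *m Eproj B = 0.
Proof. by rewrite mulmxBr mulmx1 mulmxA mpinv_outer subrr. Qed.

Lemma Eproj_idem : Eproj B *m Eproj B = Eproj B.
Proof. by rewrite {2}/Eproj mulmxBr mulmx1 mulmxA Eproj_mul mul0mx subr0. Qed.

Lemma Fproj_idem : Fproj B *m Fproj B = Fproj B.
Proof. by rewrite {1}/Fproj mulmxBl mul1mx -mulmxA mul_Fproj mulmx0 subr0. Qed.

Lemma mpinv_colrange k (U : 'M[C]_(m, k)) :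
  (colrange U <= colrange B)%VS -> B *m mpinv B *m U = U.
Proof.
move=> /subvP sUB; apply/trmx_inj/row_matrixP => j.
rewrite -!tr_col; congr (_ ^T).
have /sUB/colrangeP[x Ux] : col j U \in colrange U.
  by apply/colrangeP; exists (delta_mx j 0); rewrite colE.
by rewrite colE -mulmxA -colE Ux mulmxA mpinv_inner.
Qed.

End PenroseEquations.

(** The correction factors K and L have this shape, with P an orthogonal
    projector: P = P P^* turns the sum into identity plus a Gram matrix. *)
Lemma unitmx_add1_proj (C : numClosedFieldType) n r
    (X : 'M[C]_(n, r)) (P : 'M[C]_r) :
  P ^t* = P -> P *m P = P -> 1%:M + X *m P *m X ^t* \in unitmx.
Proof.
move=> hP PP; suff -> : X *m P *m X ^t* = (X *m P) *m (X *m P) ^t*.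
  exact: unitmx_add1_gram.
by rewrite trmxC_mul hP mulmxA -(mulmxA X P P) PP.
Qed.

Lemma add1_proj_herm (C : numClosedFieldType) n r
    (X : 'M[C]_(n, r)) (P : 'M[C]_r) :
  P ^t* = P -> (1%:M + X *m P *m X ^t*) ^t* = 1%:M + X *m P *m X ^t*.
Proof. by move=> hP; rewrite trmxCD trmxC1 !trmxC_mul trmxCK hP mulmxA. Qed.

Section RankUpdate.
Variables (C : numClosedFieldType) (m n r : nat).
Variables (A : 'M[C]_(m, n)) (U : 'M[C]_(m, r)) (V : 'M[C]_(n, r)).
Hypothesis AU : A *m mpinv A *m U = U.
Hypothesis VA : V ^t* *m mpinv A *m A = V ^t*.

Let X := mpinv A *m U.
Let Y := V ^t* *m mpinv A.
Let S := 1%:M + Y *m U.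
Let E := Eproj S.
Let F := Fproj S.
Let M := A + U *m V ^t*.
Let G := mpinv A - X *m mpinv S *m Y.
Let K := 1%:M + X *m F *m X ^t*.
Let L := 1%:M + Y ^t* *m E *m Y.

Let AX : A *m X = U. Proof. by rewrite mulmxA. Qed.
Let YU : Y *m U = S - 1%:M. Proof. by rewrite /S addrAC subrr add0r. Qed.
Let VX : V ^t* *m X = S - 1%:M. Proof. by rewrite mulmxA YU. Qed.

Let EYU : E *m Y *m U = - E.
Proof. by rewrite -mulmxA YU mulmxBr Eproj_mul mulmx1 sub0r. Qed.

Let VXF : V ^t* *m X *m F = - F.
Proof. by rewrite VX mulmxBl mul_Fproj mul1mx sub0r. Qed.

Let MXF : M *m X *m F = 0.
Proof. by rewrite mulmxDl AX mulmxDl -!(mulmxA U) VXF mulmxN subrr. Qed.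

Let EYM : E *m Y *m M = 0.
Proof. by rewrite mulmxDr (mulmxA _ U) EYU -mulmxA VA mulNmx subrr. Qed.

Let MX : M *m X = U *m S.
Proof. by rewrite mulmxDl AX -mulmxA VX mulmxBr mulmx1 addrC subrK. Qed.

Let YM : Y *m M = S *m V ^t*.
Proof. by rewrite mulmxDr VA mulmxA YU mulmxBl mul1mx addrC subrK. Qed.

Let MG : M *m G = A *m mpinv A + U *m E *m Y.
Proof.
rewrite [M *m G]mulmxBr -(mulmxA X) (mulmxA M X) MX [M *m mpinv A]mulmxDl.
rewrite -(mulmxA U (V ^t*)) -/Y -addrA [U *m E]mulmxBr mulmx1 mulmxBl.
by rewrite -(mulmxA U S) (mulmxA S) (mulmxA U _ Y).
Qed.

Let GM : G *m M = mpinv A *m A + X *m F *m V ^t*.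
Proof.
rewrite [G *m M]mulmxBl -(mulmxA _ Y M) YM [mpinv A *m M]mulmxDr.
rewrite (mulmxA (mpinv A) U) -/X -addrA [X *m F]mulmxBr mulmx1 mulmxBl.
by rewrite -(mulmxA X _ (S *m _)) (mulmxA _ S) (mulmxA X).
Qed.

Let MK : M *m K = M.
Proof. by rewrite [M *m K]mulmxDr mulmx1 (mulmxA M (X *m F)) (mulmxA M X F) MXF mul0mx addr0. Qed.

Let LM : L *m M = M.
Proof. by rewrite [L *m M]mulmxDl mul1mx -(mulmxA _ E) -(mulmxA _ _ M) EYM mulmx0 addr0. Qed.

Let uK : K \in unitmx.
Proof. exact: unitmx_add1_proj (Fproj_herm S) (Fproj_idem S). Qed.

Let uL : L \in unitmx.
Proof.
by rewrite /L -{2}[Y]trmxCK; apply: unitmx_add1_proj (Eproj_herm S) (Eproj_idem S).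
Qed.

Let hK : K ^t* = K. Proof. exact: add1_proj_herm (Fproj_herm S). Qed.

Let hL : L ^t* = L.
Proof. by rewrite /L -{2 4}[Y]trmxCK; apply: add1_proj_herm (Eproj_herm S). Qed.

Let MKV : M *m invmx K = M. Proof. by rewrite -{1}MK mulmxK. Qed.
Let LVM : invmx L *m M = M. Proof. by rewrite -{1}LM mulKmx. Qed.

(** The summand X F V^* of G M dies under M because M X F = 0: G is always an
    inner inverse of M, and so is N. *)
Let MGM : M *m G *m M = M.
Proof.
rewrite -mulmxA GM [M *m (_ + _)]mulmxDr (mulmxA M (X *m F)) (mulmxA M X F) MXF mul0mx addr0.
by rewrite mulmxA 2!mulmxDl mpinv_inner -!(mulmxA U) VA.
Qed.

Let N := invmx K *m G *m invmx L.

Let MN : M *m N = M *m G *m invmx L. Proof. by rewrite !(mulmxA M) MKV. Qed.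
Let NM : N *m M = invmx K *m (G *m M). Proof. by rewrite -!(mulmxA _ _ M) LVM -mulmxA. Qed.

(** Since L M = M, the congruence by L strips the factor L^-1 from M N. *)
Let MN_herm : (M *m N) ^t* = M *m N <-> (U *m E *m Y) ^t* = U *m E *m Y.
Proof.
apply: (iff_trans (hermitian_congr _ uL hL)).
rewrite MN -(mulmxA L) mulmxKV // mulmxA LM MG.
exact: hermitian_addl (mpinv_herml A).
Qed.

Let NM_herm : (N *m M) ^t* = N *m M <-> (X *m F *m V ^t*) ^t* = X *m F *m V ^t*.
Proof.
apply: (iff_trans (hermitian_congr _ uK hK)).
rewrite NM mulKVmx // -mulmxA MK GM.
exact: hermitian_addl (mpinv_hermr A).
Qed.

(** With Y U = S - I, the product G U is X (F + S^+), and S^+ E = 0. *)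
Let GUE : G *m U *m E = X *m F *m E.
Proof.
rewrite mulmxBl -/X -(mulmxA _ Y) YU.
have -> : X - X *m mpinv S *m (S - 1%:M) = X *m F + X *m mpinv S.
  by rewrite !mulmxBr !mulmx1 opprB addrCA addrC mulmxA.
by rewrite mulmxDl -(mulmxA X (mpinv S)) mpinv_Eproj mulmx0 addr0.
Qed.

Let NMN_N : N *m M *m N = N <-> X *m F *m E *m Y = 0.
Proof.
have GAA : G *m (A *m mpinv A) = G.
  rewrite mulmxBl mulmxA mpinv_outer -(mulmxA _ Y) /Y.
  by rewrite -(mulmxA (V ^t*)) (mulmxA (mpinv A)) mpinv_outer.
have GMG : G *m (M *m G) = G + X *m F *m E *m Y.
  by rewrite MG mulmxDr GAA !mulmxA GUE.
have -> : N *m M *m N = invmx K *m (G *m (M *m G)) *m invmx L.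
  by rewrite NM -mulmxA -(mulmxA G) MN !mulmxA.
rewrite GMG; split=> [e|->]; last by rewrite addr0.
apply: (@addrI _ G); rewrite addr0.
have uKV : invmx K \in unitmx by rewrite unitmx_inv.
have uLV : invmx L \in unitmx by rewrite unitmx_inv.
by apply: (can_inj (mulKmx uKV)); apply: (can_inj (mulmxK uLV)).
Qed.

(** The theorem with the range inclusions replaced by the equations
    A A^+ U = U and V^* A^+ A = V^*, and with the adjoints absorbed in X and Y:
    U^* (A^+)^* is X^* and (A^+)^* V is Y^*. *)
Lemma mpinv_update_iff :
  mpinv M = N <->
  [/\ (U *m E *m Y) ^t* = U *m E *m Y,
      (X *m F *m V ^t*) ^t* = X *m F *m V ^t* & X *m F *m E *m Y = 0].
Proof.
apply: (iff_trans (mpinv_penrose _ _)); split.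
  by case=> _ /NMN_N ? /MN_herm ? /NM_herm.
case=> /MN_herm ? /NM_herm ? /NMN_N ?; split=> //.
by rewrite MN -mulmxA LVM MGM.
Qed.

End RankUpdate.

Theorem theorem3p7 (R : realType) (m n r : nat)
    (A : 'M[R[i]]_(m, n)) (U : 'M[R[i]]_(m, r)) (V : 'M[R[i]]_(n, r))
    (hU : (colrange U <= colrange A)%VS) (hV : (colrange V <= colrange (A ^t*))%VS) :
  let Ad := mpinv A in
  let S := 1%:M + V ^t* *m Ad *m U in
  mpinv (A + U *m V ^t*) =
      invmx (1%:M + Ad *m U *m Fproj S *m U ^t* *m Ad ^t*)
        *m (Ad - Ad *m U *m mpinv S *m V ^t* *m Ad)
        *m invmx (1%:M + Ad ^t* *m V *m Eproj S *m V ^t* *m Ad)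
  <->
  [/\ U *m Eproj S *m V ^t* *m Ad \is hermsymmx,
      Ad *m U *m Fproj S *m V ^t* \is hermsymmx
    & Ad *m U *m Fproj S *m Eproj S *m V ^t* *m Ad = 0].
Proof.
move=> Ad S.
have AU := mpinv_colrange hU.
have VA : V ^t* *m Ad *m A = V ^t*.
  (* A^+ A is Hermitian and fixes A^*, hence fixes every column of V; the
     claim is the adjoint of that. *)
  have AAV : Ad *m A *m V = V.
    rewrite -(mpinv_colrange hV) !mulmxA; congr (_ *m _ *m _).
    by rewrite -mpinv_hermr -trmxC_mul mulmxA mpinv_inner.
  by rewrite -mulmxA -mpinv_hermr -trmxC_mul AAV.
have := mpinv_update_iff AU VA.
rewrite -/Ad -/S !trmxC_mul trmxCK !mulmxA => main.
apply: (iff_trans main); split.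
  by case=> h1 h2 h3; split=> //; apply/hermsymmxP; rewrite !trmxC_mul !mulmxA ?trmxCK.
by case=> /hermsymmxP + /hermsymmxP; rewrite !trmxC_mul !mulmxA ?trmxCK => *; split.
Qed.
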